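(* Let $k\ge 4$ be an integer with $k\not\equiv 0\pmod{4}$. Then for each choice of the sign $\pm$, the Diophantine equation $x^3\pm y^3=a^k-b^k$ has infinitely many nontrivial solutions $(x,y,a,b)$ in positive integers.
   Context: A quadruple $(x,y,a,b)$ of integers is called a nontrivial solution of an equation $x^3\pm y^3=a^k\pm b^k$ (signs fixed) if $\gcd(x,y,a,b)=1$ and no partial sum in the expression $x^3\pm y^3-(a^k\pm b^k)$ vanishes. *)

(* Defs.v *)
From mathcomp Require Import all_boot all_order all_algebra.
From mathcomp Require Import classical_sets cardinality.
Set Implicit Arguments.
Unset Strict Implicit.
Unset Printing Implicit Defensive.
Import GRing.Theory Num.Theory.
Local Open Scope ring_scope.

(* The equation x^3 +- y^3 = a^k +- b^k is encoded by two booleans: s is the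
   sign in front of y^3 and t the sign in front of b^k, with false for + and
   true for -. *)

Definition signed_terms (s t : bool) (k : nat) (x y a b : int) : 4.-tuple int :=
  [tuple x ^+ 3; (-1) ^+ s * y ^+ 3; - a ^+ k; - ((-1) ^+ t * b ^+ k)].

(* A partial sum is the sum over a nonempty proper subset of the terms; the sum
   of all the terms vanishes at every solution. *)
Definition no_vanishing_partial_sum (n : nat) (u : n.-tuple int) : Prop :=
  forall S : {set 'I_n},
    S != finset.set0 -> S != [set: 'I_n]%SET -> \sum_(i in S) tnth u i != 0.

Definition nontrivial_solution (s t : bool) (k : nat) (x y a b : int) : Prop :=
  [/\ x ^+ 3 + (-1) ^+ s * y ^+ 3 = a ^+ k + (-1) ^+ t * b ^+ k,
      gcdz (gcdz x y) (gcdz a b) = 1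
    & no_vanishing_partial_sum (signed_terms s t k x y a b)].

(* Main.v *)
Require Import Defs.
From mathcomp Require Import all_boot all_order all_algebra.
From mathcomp Require Import classical_sets cardinality.
From mathcomp Require Import zify ring lra.
Set Implicit Arguments.
Unset Strict Implicit.
Unset Printing Implicit Defensive.
Import Order.TTheory GRing.Theory Num.Theory.
Local Open Scope ring_scope.
Local Open Scope classical_set_scope.

(** Ramanujan's identity
      [S^12 - (9 T^4)^3 = (S^4 - 9 T^3 S)^3 + (3 T S^3 - 9 T^4)^3]
    writes a difference of two monomials as a sum of two cubes; replacing [T]
    by [- T] makes it a difference of two cubes.  With [S = r^k] the first
    monomial is the [k]-th power of [r^12]; with [T = 3^j] the second one is
    [3^(12 j + 6)], which is a [k]-th power [(3^i)^k] for suitable [i, j]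
    as soon as [4] does not divide [k].  Taking [r] prime to [3] makes the
    solution primitive, and taking it large fixes all the signs. *)

(** Since the total vanishes, a subset and its complement have opposite sums. Hence the four
    singletons and the three pairs containing [u0] settle all nonempty proper subsets. *)
Lemma no_vanishing_partial_sum4 (u0 u1 u2 u3 : int) :
  u0 + u1 + u2 + u3 = 0 ->
  u0 != 0 -> u1 != 0 -> u2 != 0 -> u3 != 0 ->
  u0 + u1 != 0 -> u0 + u2 != 0 -> u0 + u3 != 0 ->
  no_vanishing_partial_sum [tuple u0; u1; u2; u3].
Proof.
move=> sum0 u0N0 u1N0 u2N0 u3N0 u01 u02 u03 A AN0 ANT.
have in4 (P : 'I_4 -> Prop) : P (inord 0) -> P (inord 1) -> P (inord 2) ->
    P (inord 3) -> forall i, P i.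
  move=> P0 P1 P2 P3 i; rewrite -[i]inord_val.
  by case: i => -[|[|[|[|]]]].
have: ~~ [&& inord 0 \in A, inord 1 \in A, inord 2 \in A & inord 3 \in A].
  apply: contra ANT => /and4P[A0 A1 A2 A3]; apply/eqP/setP.
  by apply: in4; rewrite inE.
have: [|| inord 0 \in A, inord 1 \in A, inord 2 \in A | inord 3 \in A].
  apply: contraNT AN0; rewrite !negb_or => /and4P[A0 A1 A2 A3].
  by apply/eqP/setP; apply: in4; rewrite finset.in_set0; apply: negbTE.
rewrite big_mkcond /= !big_ord_recl big_ord0 !(tnth_nth 0) /=.
have -> : lift ord0 (lift ord0 (lift ord0 ord0)) = inord 3 :> 'I_4.
  by apply: val_inj; rewrite /= inordK.
have -> : lift ord0 (lift ord0 ord0) = inord 2 :> 'I_4.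
  by apply: val_inj; rewrite /= inordK.
have -> : lift ord0 ord0 = inord 1 :> 'I_4 by apply: val_inj; rewrite /= inordK.
have -> : ord0 = inord 0 :> 'I_4 by apply: val_inj; rewrite /= inordK.
by do 4![case: (_ \in A)] => //= _ _; lia.
Qed.

(** [12 * j + 6] is the exponent of 3 in [(9 T^4)^3] when [T = 3^j]. As 6 times the odd number
    [2 * j + 1], it is reached with [i = 6] if [k] is odd and with [i = 3] if [k] is twice an odd
    number. *)
Lemma exponent_exists (k : nat) :
  k <> 0 %[mod 4] -> exists i j : nat, (i * k = 12 * j + 6)%N.
Proof.
move=> k4; have [kodd|keven] := boolP (odd k).
  by exists 6, k./2; lia.
by exists 3, (k %/ 4)%N; lia.
Qed.

(** The bound [9 * T ^+ 3 < S ^+ 3] makes [x] and [y] positive. Then [- a ^+ k] is the only negative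
    term, and of two complementary pairs one has a positive sum, so neither sum vanishes. *)
Lemma nontrivial_plus (k : nat) (S T a b : int) :
  0 < T -> 9 * T ^+ 3 < S ^+ 3 -> 0 < S -> 0 < a -> 0 < b ->
  a ^+ k = S ^+ 12 -> b ^+ k = 3 ^+ 6 * T ^+ 12 -> gcdz a b = 1 ->
  let x := S ^+ 4 - 9 * T ^+ 3 * S in
  let y := 3 * T * S ^+ 3 - 9 * T ^+ 4 in
  [/\ 0 < x, 0 < y, 0 < a, 0 < b & nontrivial_solution false true k x y a b].
Proof.
move=> T0 ST S0 a0 b0 ak bk gab x y.
have T30 : 0 < T ^+ 3 by apply: exprn_gt0.
have x0 : 0 < x.
  have -> : x = S * (S ^+ 3 - 9 * T ^+ 3) by rewrite /x; ring.
  by apply: mulr_gt0 => //; lra.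
have y0 : 0 < y.
  have -> : y = 3 * (T * (S ^+ 3 - 3 * T ^+ 3)) by rewrite /y; ring.
  by apply: mulr_gt0 => //; apply: mulr_gt0 => //; lra.
have eqxy : x ^+ 3 + y ^+ 3 = a ^+ k - b ^+ k.
  by rewrite ak bk /x /y; ring.
have x30 : 0 < x ^+ 3 by apply: exprn_gt0.
have y30 : 0 < y ^+ 3 by apply: exprn_gt0.
have ak0 : 0 < a ^+ k by apply: exprn_gt0.
have bk0 : 0 < b ^+ k by apply: exprn_gt0.
split=> //; split; rewrite ?expr0 ?expr1 ?mul1r ?mulN1r ?gab ?gcdz1 //.
clearbody x y; clear ak bk.
by apply: no_vanishing_partial_sum4; rewrite ?expr0 ?expr1 ?mul1r ?mulN1r; lia.
Qed.

(** Two terms are now positive and two negative, so signs alone do not decide: [x ^+ 3] must differ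
    from both [y ^+ 3] and [a ^+ k], which follows from [bak] and [xak]. *)
Lemma nontrivial_minus (k : nat) (S T a b : int) :
  0 < T -> 9 * T ^+ 3 < S ^+ 3 -> 0 < S -> 0 < a -> 0 < b ->
  a ^+ k = S ^+ 12 -> b ^+ k = 3 ^+ 6 * T ^+ 12 -> gcdz a b = 1 ->
  let x := S ^+ 4 + 9 * T ^+ 3 * S in
  let y := 3 * T * S ^+ 3 + 9 * T ^+ 4 in
  [/\ 0 < x, 0 < y, 0 < a, 0 < b & nontrivial_solution true true k x y a b].
Proof.
move=> T0 ST S0 a0 b0 ak bk gab x y.
have T30 : 0 < T ^+ 3 by apply: exprn_gt0.
have S30 : 0 < S ^+ 3 by apply: exprn_gt0.
have S40 : 0 < S ^+ 4 by apply: exprn_gt0.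
have TS0 : 0 < T ^+ 3 * S by apply: mulr_gt0.
have xS : S ^+ 4 < x by rewrite /x ltrDl -mulrA mulr_gt0.
have x0 : 0 < x by apply: lt_trans xS.
have y0 : 0 < y.
  have -> : y = 3 * (T * (S ^+ 3 + 3 * T ^+ 3)) by rewrite /y; ring.
  by apply: mulr_gt0 => //; apply: mulr_gt0 => //; lra.
have eqxy : x ^+ 3 - y ^+ 3 = a ^+ k - b ^+ k.
  by rewrite ak bk /x /y; ring.
have x30 : 0 < x ^+ 3 by apply: exprn_gt0.
have y30 : 0 < y ^+ 3 by apply: exprn_gt0.
have bk0 : 0 < b ^+ k by apply: exprn_gt0.
have xak : a ^+ k < x ^+ 3.
  by rewrite ak (exprM S 4 3) ltr_pXn2r // nnegrE ltW.
have bak : b ^+ k < a ^+ k.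
  (* The factor [9 ^ 4 = 3 ^ 8] exceeds the factor [3 ^ 6] in [b ^+ k]. *)
  have h : (9 * T ^+ 3) ^+ 4 < (S ^+ 3) ^+ 4.
    by rewrite ltr_pXn2r ?nnegrE //; lra.
  rewrite ak bk (exprM S 3 4) (exprM T 3 4); apply: lt_trans h.
  rewrite exprMn; have : 0 < (T ^+ 3) ^+ 4 by apply: exprn_gt0.
  by lra.
have ak0 : 0 < a ^+ k by lra.
split=> //; split; rewrite ?expr0 ?expr1 ?mul1r ?mulN1r ?gab ?gcdz1 //.
clearbody x y; clear ST T30 S30 S40 TS0 xS ak bk.
by apply: no_vanishing_partial_sum4; rewrite ?expr0 ?expr1 ?mul1r ?mulN1r; lia.
Qed.

Theorem mainTheorem6 (k : nat) (k_ge4 : (4 <= k)%N) (k_mod4 : k <> 0 %[mod 4])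
    (s : bool) :
  infinite_set [set q : int * int * int * int |
    let: (x, y, a, b) := q in
    [/\ 0 < x, 0 < y, 0 < a, 0 < b & nontrivial_solution s true k x y a b]].
Proof.
have [i [j ikE]] := exponent_exists k_mod4.
(* Being 1 modulo 3 makes [r n] prime to [b]; the shift by [3 ^ j.+1] makes it exceed
   [9 * T = 3 * 3 ^ j.+1], and then so does [S n]. *)
pose r n : int := (3 * (n + 3 ^ j.+1) + 1)%N%:Z.
pose T : int := 3 ^+ j.
pose S n := r n ^+ k; pose a n := r n ^+ 12; pose b : int := 3 ^+ i.
pose f n : int * int * int * int :=
  if s then (S n ^+ 4 + 9 * T ^+ 3 * S n, 3 * T * S n ^+ 3 + 9 * T ^+ 4, a n, b)
  else (S n ^+ 4 - 9 * T ^+ 3 * S n, 3 * T * S n ^+ 3 - 9 * T ^+ 4, a n, b).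
have r_gt0 n : 0 < r n by rewrite /r; lia.
have T_gt0 : 0 < T by apply: exprn_gt0.
have S_gt0 n : 0 < S n by apply: exprn_gt0.
have ST n : 9 * T ^+ 3 < S n ^+ 3.
  have rT : 9 * T < r n by rewrite /T /r -natrX expnS; lia.
  have rS : r n <= S n by rewrite -[leLHS]expr1 ler_weXn2l //; lia.
  apply: (@lt_trans _ _ ((9 * T) ^+ 3)).
    by rewrite exprMn; have := exprn_gt0 3 T_gt0; lra.
  by rewrite ltr_pXn2r ?nnegrE //; lia.
have akE n : a n ^+ k = S n ^+ 12 by rewrite -!exprM mulnC.
have bkE : b ^+ k = 3 ^+ 6 * T ^+ 12.
  by rewrite /b /T -!exprM -exprD ikE; congr (_ ^+ _); lia.
have gab n : gcdz (a n) b = 1.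
  apply/eqP; apply: coprimezXl; apply: coprimezXr.
  by rewrite coprimezE /= coprime_sym prime_coprime //; lia.
set A := (X in infinite_set X).
have Af n : A (f n).
  rewrite /A /f; case: (s).
    by apply: nontrivial_minus => //; apply: exprn_gt0.
  by apply: nontrivial_plus => //; apply: exprn_gt0.
(* The third component suffices: it is the 12th power of the positive [r n], which determines
   [n]. *)
have f_inj : injective f.
  move=> m n fmn; have : a m = a n.
    by have := congr1 (fun q => q.1.2) fmn; rewrite /f; case: (s).
  move=> /eqP; rewrite eqrXn2 ?ltW // => /eqP.
  by rewrite /r; lia.
move=> /(finite_preimage (in2W f_inj)).
by apply: sub_infinite_set infinite_nat => n _; apply: Af.
Qed.
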